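(* Let $0\le q<s\le n$ and $0\le t<r\le m$ be integers. Then $$\operatorname{reg}(I_qJ_r+I_sJ_t)=r+s-1.$$
   Context: Let $K$ be a field, $n,m\ge 0$ integers, and $S=K[x_1,\dots,x_n,y_1,\dots,y_m]$ the polynomial ring in $n+m$ variables with its standard grading. For $0\le k\le n$, $I_k\subseteq S$ is the ideal generated by all square-free monomials of degree $k$ in the variables $x_1,\dots,x_n$; for $0\le l\le m$, $J_l\subseteq S$ is the ideal generated by all square-free monomials of degree $l$ in the variables $y_1,\dots,y_m$. By convention $I_0=J_0=S$. For a finitely generated graded $S$-module $M\neq 0$ with minimal graded free resolution $0\to\bigoplus_i S(-d_{g,i})\to\cdots\to\bigoplus_i S(-d_{k,i})\to\cdots\to\bigoplus_i S(-d_{0,i})\to M\to 0$, the Castelnuovo-Mumford regularity is $\operatorname{reg}(M)=\max\{d_{k,i}-k : k\ge 0,\ i\}$. *)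

(* Defs.v *)
From HB Require Import structures.
From mathcomp Require Import all_boot all_order all_algebra.
From mathcomp Require Import mpoly.

Set Implicit Arguments.
Unset Strict Implicit.
Unset Printing Implicit Defensive.

Import Order.TTheory GRing.Theory Num.Theory.
Local Open Scope ring_scope.

Section Ideals.
Variable R : comNzRingType.
Implicit Types (G I J : R -> Prop).

Definition ideal_gen G (p : R) : Prop :=
  exists (k : nat) (c g : 'I_k -> R),
    (forall i, G (g i)) /\ p = \sum_(i < k) c i * g i.

Definition ideal_add I J (p : R) : Prop :=
  exists a b : R, [/\ I a, J b & p = a + b].

Definition ideal_mul I J : R -> Prop :=
  ideal_gen (fun p => exists a b : R, [/\ I a, J b & p = a * b]).

End Ideals.

(* Graded modules over S = K[X_0, ..., X_(N-1)].  A graded module is given as  *)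
(* a submodule M of an S-module V, together with a predicate hom such that     *)
(* hom d v says that v is homogeneous of degree d.                             *)
Section Regularity.
Variables (K : fieldType) (N : nat).
Local Notation S := {mpoly K[N]}.

(* Membership in the degree d component S_d; S_d = 0 for d < 0.               *)
Definition homog_poly (d : int) (p : S) : Prop :=
  match d with
  | Posz e => p \is e.-homog
  | Negz _ => p = 0
  end.

Variables (V : lmodType S) (hom : int -> V -> Prop) (M : V -> Prop).

(* A sequence ... -> F_1 -> F_0 -> V, where F_k is the sum of the              *)
(* S(- shift k i), i < rank k.  Elements of F_k are row vectors, and the map   *)
(* F_(k+1) -> F_k is right multiplication by diff k.                           *)
Record free_sequence := FreeSequence {
  rank : nat -> nat;
  shift : forall k, 'I_(rank k) -> int;
  diff : forall k, 'M[S]_(rank k.+1, rank k);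
  aug : 'I_(rank 0) -> V }.

Definition augment (F : free_sequence) (v : 'rV[S]_(rank F 0)) : V :=
  \sum_i v 0 i *: aug i.

Definition degree_preserving (F : free_sequence) : Prop :=
  (forall i, hom (shift i) (aug (f := F) i)) /\
  (forall k i j, homog_poly (@shift F k.+1 i - @shift F k j) (diff F k i j)).

Definition exact (F : free_sequence) : Prop :=
  [/\ forall x : V, M x <-> exists v, x = augment (F := F) v,
      forall v, augment (F := F) v = 0 <-> exists w, v = w *m diff F 0
    & forall k (v : 'rV[S]_(rank F k.+1)),
        v *m diff F k = 0 <-> exists w, v = w *m diff F k.+1].

Definition finite_length (F : free_sequence) : Prop :=
  exists g : nat, forall k, (g < k)%N -> rank F k = 0%N.

(* The image of F_(k+1) lies in (X_0, ..., X_(N-1)) F_k.                       *)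
Definition minimal (F : free_sequence) : Prop :=
  forall k i j, (diff F k i j)@_(0%MM) = 0.

Definition minimal_graded_free_resolution (F : free_sequence) : Prop :=
  [/\ degree_preserving F, exact F, finite_length F & minimal F].

Definition max_shift (F : free_sequence) (rho : int) : Prop :=
  (exists (k : nat) (i : 'I_(rank F k)), shift i - k%:Z = rho) /\
  (forall (k : nat) (i : 'I_(rank F k)), shift i - k%:Z <= rho).

(* The minimal resolution is only unique up to isomorphism: reg(M) = rho means *)
(* that there is one, and that every one of them gives the value rho.          *)
Definition has_regularity (rho : int) : Prop :=
  (exists F, minimal_graded_free_resolution F) /\
  (forall F, minimal_graded_free_resolution F -> max_shift F rho).

End Regularity.

(* I, viewed as a graded submodule of the regular module S.                    *)
Definition ideal_has_regularity (K : fieldType) (N : nat)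
    (I : {mpoly K[N]} -> Prop) (rho : int) : Prop :=
  has_regularity (V := {mpoly K[N]}^o) (@homog_poly K N) I rho.

(* In K[x_1, ..., x_n, y_1, ..., y_m], the x's are the first n variables and   *)
(* the y's the last m ones.                                                    *)
Section SquareFree.
Variables (K : fieldType) (n m : nat).
Local Notation S := {mpoly K[n + m]}.

Definition xvar (i : 'I_n) : S := 'X_(lshift m i).
Definition yvar (j : 'I_m) : S := 'X_(rshift n j).

Definition sqfree_x (k : nat) : S -> Prop :=
  ideal_gen (fun p => exists2 A : {set 'I_n}, #|A| = k & p = \prod_(i in A) xvar i).

Definition sqfree_y (l : nat) : S -> Prop :=
  ideal_gen (fun p => exists2 A : {set 'I_m}, #|A| = l & p = \prod_(j in A) yvar j).

End SquareFree.
Arguments sqfree_x : clear implicits.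
Arguments sqfree_y : clear implicits.

(* Main.v *)
(* Write P = I_q J_r and Q = I_s J_t, so that P \cap Q = I_s J_r.  Each of P, Q
   and P \cap Q has a linear resolution.  The mapping cone of the comparison
   maps from the resolution of P \cap Q to those of P and Q resolves P + Q; it
   is minimal because P \cap Q is generated in degree r + s, larger than the
   degrees q + r and s + t of P and Q, so the comparison maps have no constant
   entries.  The part coming from P \cap Q contributes r + s - 1.

   The linear resolutions are built by the same cone, adding one variable a to
   a set A of variables at a time: squarefree monomials satisfy
   I_(a |: A, k+1) = I_(A, k+1) + X_a I_(A, k), and the intersection of the two
   summands is X_a I_(A, k+1). *)

Require Import Defs.
From mathcomp Require Import all_boot all_order all_algebra.
From mathcomp Require Import mpoly.
From mathcomp Require Import zify ring.
From Stdlib Require Import IndefiniteDescription.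

Set Implicit Arguments.
Unset Strict Implicit.
Unset Printing Implicit Defensive.

Import Order.TTheory GRing.Theory Num.Theory.
Local Open Scope ring_scope.

(** * Monomial ideals by support, graded components and homogeneous matrices *)

Section Support.
Variables (K : fieldType) (N : nat).
Local Notation S := {mpoly K[N]}.
Implicit Types (P Q : pred 'X_{1..N}) (p q g : S).

(** This is the [K]-span of the monomials with exponent in [Q]. Sums and intersections of such spans
    become unions and intersections of predicates. *)
Definition monomial_ideal Q p : Prop := all Q (msupp p).

Lemma monomial_idealP Q p :
  monomial_ideal Q p <-> forall m, ~~ Q m -> p@_m = 0.
Proof.
split=> [/allP Qp m NQm | Qp].
  by apply: memN_msupp_eq0; apply: contra NQm => /Qp.
apply/allP=> m; rewrite mcoeff_msupp; apply: contraR => /Qp ->.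
by rewrite eqxx.
Qed.

Lemma monomial_ideal0 Q : monomial_ideal Q 0.
Proof. by apply/monomial_idealP => m _; rewrite mcoeff0. Qed.

Lemma monomial_idealD Q p q :
  monomial_ideal Q p -> monomial_ideal Q q -> monomial_ideal Q (p + q).
Proof.
move=> /monomial_idealP Qp /monomial_idealP Qq; apply/monomial_idealP => m Nm.
by rewrite mcoeffD Qp // Qq // addr0.
Qed.

Lemma monomial_idealZ Q c p : monomial_ideal Q p -> monomial_ideal Q (c *: p).
Proof.
move=> /monomial_idealP Qp; apply/monomial_idealP => m Nm.
by rewrite mcoeffZ Qp // mulr0.
Qed.

Lemma monomial_ideal_sum I (r : seq I) (R : pred I) (f : I -> S) Q :
  (forall i, R i -> monomial_ideal Q (f i)) ->
  monomial_ideal Q (\sum_(i <- r | R i) f i).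
Proof.
move=> Qf; apply: big_ind => //; first exact: monomial_ideal0.
exact: monomial_idealD.
Qed.

Lemma monomial_idealX Q m : Q m -> monomial_ideal Q 'X_[m].
Proof. by rewrite /monomial_ideal msuppX /= andbT. Qed.

Lemma monomial_idealM (P Q R : pred 'X_{1..N}) p q :
  (forall a b, P a -> Q b -> R (a + b)%MM) ->
  monomial_ideal P p -> monomial_ideal Q q -> monomial_ideal R (p * q).
Proof.
move=> PQR /allP Pp /allP Qq; apply/allP=> m /msuppM_le /allpairsP[[a b] /=].
by case=> /Pp Pa /Qq Qb ->; apply: PQR.
Qed.

Lemma sub_monomial_ideal P Q p :
  (forall m, P m -> Q m) -> monomial_ideal P p -> monomial_ideal Q p.
Proof. by move=> PQ; apply: sub_all. Qed.

(** The projection that keeps the terms with exponent in [Q]; for [of_degree d] it is the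
    homogeneous component of degree [d]. *)
Definition restrict Q p : S := \sum_(m <- msupp p | Q m) p@_m *: 'X_[m].

Lemma mcoeff_restrict Q p m : (restrict Q p)@_m = if Q m then p@_m else 0.
Proof.
rewrite /restrict raddf_sum /=.
under eq_bigr do rewrite mcoeffZ mcoeffX.
case: (boolP (m \in msupp p)) => [pm | Npm]; last first.
  rewrite (memN_msupp_eq0 Npm) if_same big_seq_cond big1 // => m' /andP[pm' _].
  by case: eqP pm' Npm => [->->|_ _ _] //; rewrite mulr0.
case: (boolP (Q m)) => Qm.
  rewrite -big_filter (bigD1_seq m) ?mem_filter ?Qm ?filter_uniq ?msupp_uniq //=.
  rewrite eqxx mulr1 big1 ?addr0 // => m' /negPf->; by rewrite mulr0.
rewrite big1 // => m' Qm'; case: eqP => [E|]; last by rewrite mulr0.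
by rewrite -E Qm' in Qm.
Qed.

Lemma restrictD Q : {morph restrict Q : p q / p + q}.
Proof.
move=> p q; apply/mpolyP=> m; rewrite !(mcoeffD, mcoeff_restrict).
by case: ifP; rewrite ?addr0.
Qed.

Lemma restrict0 Q : restrict Q 0 = 0.
Proof. by apply/mpolyP=> m; rewrite mcoeff_restrict mcoeff0 if_same. Qed.

Lemma restrict_sum I (r : seq I) (f : I -> S) Q :
  restrict Q (\sum_(i <- r) f i) = \sum_(i <- r) restrict Q (f i).
Proof. exact: (big_morph _ (restrictD Q) (restrict0 Q)). Qed.

Lemma monomial_ideal_restrict P Q p :
  monomial_ideal P p -> monomial_ideal (predI P Q) (restrict Q p).
Proof.
move=> /monomial_idealP Pp; apply/monomial_idealP => m /=.
by rewrite mcoeff_restrict negb_and; case: (Q m) => //=; rewrite orbF => /Pp.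
Qed.

Lemma restrict_in Q p : monomial_ideal Q p -> restrict Q p = p.
Proof.
move=> /monomial_idealP Qp; apply/mpolyP=> m; rewrite mcoeff_restrict.
by case: ifPn => // /Qp.
Qed.

Lemma restrict_out Q p : monomial_ideal (predC Q) p -> restrict Q p = 0.
Proof.
move=> /monomial_idealP Qp; apply/mpolyP=> m; rewrite mcoeff_restrict mcoeff0.
by case: ifP => // Qm; apply: Qp; rewrite /= Qm.
Qed.

Lemma monomial_ideal_predT p : monomial_ideal xpredT p.
Proof. exact: all_predT. Qed.

Lemma restrictK Q p : restrict Q p + restrict (predC Q) p = p.
Proof.
apply/mpolyP=> m; rewrite mcoeffD !mcoeff_restrict /=.
by case: (Q m); rewrite ?addr0 ?add0r.
Qed.

Lemma monomial_ideal_restrictW Q p : monomial_ideal Q (restrict Q p).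
Proof. exact: (monomial_ideal_restrict _ (monomial_ideal_predT p)). Qed.

Definition of_degree (d : int) : pred 'X_{1..N} := fun m => (mdeg m)%:Z == d.

Lemma homog_polyE d p : homog_poly d p <-> monomial_ideal (of_degree d) p.
Proof.
rewrite /monomial_ideal; case: d => [d | d] /=.
  by rewrite dhomogE; split; apply: sub_all => m /=; rewrite /of_degree => /eqP; lia.
split=> [->|/allP H]; first by rewrite msupp0.
apply: msuppnil0; case: (msupp p) H => // m s /(_ m (mem_head _ _)).
by rewrite /of_degree; lia.
Qed.

Lemma homog_poly0 d : homog_poly d (0 : S).
Proof. by apply/homog_polyE/monomial_ideal0. Qed.

Lemma homog_polyN d p : homog_poly d p -> homog_poly d (- p).
Proof. by move=> /homog_polyE ?; rewrite -scaleN1r; apply/homog_polyE/monomial_idealZ. Qed.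

Lemma homog_polyM d e p q :
  homog_poly d p -> homog_poly e q -> homog_poly (d + e) (p * q).
Proof.
move=> /homog_polyE hp /homog_polyE hq; apply/homog_polyE.
apply: monomial_idealM hp hq => a b; rewrite /of_degree mdegD.
by move=> /eqP <- /eqP <-; rewrite PoszD.
Qed.

Lemma homog_poly_sum d I (r : seq I) (f : I -> S) :
  (forall i, homog_poly d (f i)) -> homog_poly d (\sum_(i <- r) f i).
Proof.
move=> hf; apply/homog_polyE/monomial_ideal_sum => i _.
exact/homog_polyE.
Qed.

Lemma homog_poly_coef0 d p : homog_poly d p -> p@_0%MM != 0 -> d = 0.
Proof.
move=> /homog_polyE /allP hp; rewrite -mcoeff_msupp => /hp.
by rewrite /of_degree mdeg0 => /eqP.
Qed.

Lemma homog_poly1 : homog_poly 0 (1 : S).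
Proof. exact: dhomog1. Qed.

Lemma homog_polyXU (i : 'I_N) : homog_poly 1 ('X_i : S).
Proof. by rewrite /= dhomogX /= mdeg1. Qed.

(** Under this condition right multiplication by [A] is a degree 0 map between the free modules with
    shifts [s] and [t]. *)
Definition homog_mx a b (s : 'I_a -> int) (t : 'I_b -> int) (A : 'M[S]_(a, b)) :=
  forall i j, homog_poly (s i - t j) (A i j).

Lemma homog_mx_mul a b c (s : 'I_a -> int) (t : 'I_b -> int) (u : 'I_c -> int) A B :
  homog_mx s t A -> homog_mx t u B -> homog_mx s u (A *m B).
Proof.
move=> hA hB i k; rewrite mxE; apply: homog_poly_sum => j.
by rewrite -(subrKA (t j)); apply: homog_polyM.
Qed.

(** Multiplication by [g] raises degrees by [d], so only the component of [v] in degree [e - d]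
    reaches degree [e]. *)
Lemma restrict_of_degreeM d e v g :
  homog_poly d g ->
  restrict (of_degree e) (v * g) = restrict (of_degree (e - d)) v * g.
Proof.
move=> hg; set w := restrict _ v.
rewrite -[in LHS](restrictK (of_degree (e - d)) v) mulrDl restrictD.
rewrite [X in X + _]restrict_in; last first.
  apply/homog_polyE; rewrite -[X in homog_poly X _](subrK d); apply: homog_polyM => //.
  exact/homog_polyE/monomial_ideal_restrictW.
rewrite [X in _ + X]restrict_out ?addr0 //.
apply: (@monomial_idealM (predC (of_degree (e - d))) (of_degree d)).
- by move=> a b; rewrite /= /of_degree mdegD; lia.
- exact: monomial_ideal_restrictW.
- exact/homog_polyE.
Qed.

(** Cutting each entry of [X] down to its expected degree leaves the product unchanged, since [A]
    and [B] are homogeneous. *)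
Lemma homog_mx_lift a b c (s : 'I_a -> int) (t : 'I_b -> int) (u : 'I_c -> int) A X B :
  homog_mx s u A -> homog_mx t u B -> A = X *m B ->
  exists2 Y : 'M[S]_(a, b), homog_mx s t Y & A = Y *m B.
Proof.
move=> hA hB EA; exists (\matrix_(i, j) restrict (of_degree (s i - t j)) (X i j)).
  by move=> i j; rewrite mxE; apply/homog_polyE/monomial_ideal_restrictW.
apply/matrixP => i k; rewrite mxE.
rewrite -(restrict_in (proj1 (homog_polyE _ _) (hA i k))) EA mxE restrict_sum.
apply: eq_bigr => j _; rewrite mxE (restrict_of_degreeM _ _ (hB j k)).
by congr (restrict (of_degree _) _ * _); ring.
Qed.

(** Reduction modulo the ideal of all variables. *)
Definition residue a b (A : 'M[S]_(a, b)) : 'M[K]_(a, b) := map_mx (mcoeff 0%MM) A.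

Lemma residueM a b c (A : 'M[S]_(a, b)) (B : 'M_(b, c)) :
  residue (A *m B) = residue A *m residue B.
Proof. exact: map_mxM. Qed.

Lemma factor_rows a b c (A : 'M[S]_(a, c)) (B : 'M[S]_(b, c)) :
  (forall i, exists w, row i A = w *m B) -> exists X, A = X *m B.
Proof.
move=> /fin_all_exists[f Hf]; exists (\matrix_i f i).
by apply/row_matrixP=> i; rewrite row_mul rowK.
Qed.

End Support.

(** Dependent choice in a family of types: [good] is the invariant that keeps the next choice
    possible. *)
Lemma dependent_sequence (T : nat -> Type) (good : forall k, T k -> Prop)
    (rel : forall k, T k -> T k.+1 -> Prop) (x0 : T 0) :
  good 0 x0 ->
  (forall k x, good k x -> exists2 y, good k.+1 y & rel k x y) ->
  exists f : forall k, T k,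
    [/\ f 0 = x0, forall k, good k (f k) & forall k, rel k (f k) (f k.+1)].
Proof.
move=> good0 step.
have stepS k (x : {x | good k x}) : {y : {y | good k.+1 y} | rel k (sval x) (sval y)}.
  apply: constructive_indefinite_description.
  by have [y gy xy] := step k _ (svalP x); exists (exist _ y gy).
pose f := fix f k : {x | good k x} :=
  if k is k'.+1 then sval (stepS k' (f k')) else exist _ x0 good0.
exists (fun k => sval (f k)); split=> // k; first exact: svalP.
exact: (svalP (stepS k (f k))).
Qed.

(** * Comparison maps and the invariance of shifts in minimal resolutions *)

Section Resolutions.
Variables (K : fieldType) (N : nat).
Local Notation S := {mpoly K[N]}.
Implicit Types (F G H : free_sequence ({mpoly K[N]}^o)) (I J : {mpoly K[N]}^o -> Prop).

Definition aug_col F : 'M[S]_(rank F 0, 1) := \col_i (aug (f := F) i : S).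

Lemma augmentE F (v : 'rV[S]_(rank F 0)) : (v *m aug_col F) 0 0 = augment v.
Proof. by rewrite mxE; apply: eq_bigr => j _; rewrite mxE. Qed.

Lemma augment_eq0 F (v : 'rV[S]_(rank F 0)) : v *m aug_col F = 0 <-> augment v = 0.
Proof.
rewrite -augmentE; split=> [->|E]; first by rewrite mxE.
by apply/matrixP=> i j; rewrite !ord1 E mxE.
Qed.

Lemma aug_in I F i : exact I F -> I (aug (f := F) i).
Proof.
case=> HI _ _; apply/HI; exists (delta_mx 0 i).
by rewrite -augmentE -rowE !mxE.
Qed.

Lemma diff0_aug I F : exact I F -> diff F 0 *m aug_col F = 0.
Proof.
case=> _ ex0 _; apply/row_matrixP=> i; rewrite row_mul row0.
by apply/augment_eq0/ex0; exists (delta_mx 0 i); rewrite -rowE.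
Qed.

Lemma diff_diff I F k : exact I F -> diff F k.+1 *m diff F k = 0.
Proof.
case=> _ _ exS; apply/row_matrixP=> i; rewrite row_mul row0.
by apply/exS; exists (delta_mx 0 i); rewrite -rowE.
Qed.

Lemma factor_diff0 I F p (A : 'M[S]_(p, rank F 0)) :
  exact I F -> A *m aug_col F = 0 -> exists X, A = X *m diff F 0.
Proof.
case=> _ ex0 _ A0; apply: factor_rows => i.
by apply/ex0/augment_eq0; rewrite -row_mul A0 row0.
Qed.

Lemma factor_diff I F k p (A : 'M[S]_(p, rank F k.+1)) :
  exact I F -> A *m diff F k = 0 -> exists X, A = X *m diff F k.+1.
Proof.
case=> _ _ exS A0; apply: factor_rows => i.
by apply/exS; rewrite -row_mul A0 row0.
Qed.

Definition graded F := degree_preserving (V := S^o) (@homog_poly K N) F.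

Lemma graded_aug F : graded F -> homog_mx (shift (f := F) (k := 0)) (fun=> 0) (aug_col F).
Proof. by case=> haug _ i j; rewrite mxE subr0. Qed.

Lemma graded_diff F k :
  graded F -> homog_mx (shift (f := F) (k := k.+1)) (shift (f := F) (k := k)) (diff F k).
Proof. by case=> _ hdiff i j; apply: hdiff. Qed.

(** The inclusion of [I] in [J] lifts to a graded chain map: exactness of [G] supplies each next
    matrix, and [homog_mx_lift] makes it homogeneous. Vectors are rows, so composites read from left
    to right. *)
Lemma comparison_map I J F G :
  graded F -> graded G -> exact I F -> exact J G -> (forall x, I x -> J x) ->
  exists phi : forall k, 'M[S]_(rank F k, rank G k),
    [/\ forall k, homog_mx (shift (f := F) (k := k)) (shift (f := G) (k := k)) (phi k),
        aug_col F = phi 0 *m aug_col G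
      & forall k, diff F k *m phi k = phi k.+1 *m diff G k].
Proof.
move=> gF gG eF eG IJ.
have [phi0 hphi0 aug0]: exists2 X : 'M[S]_(rank F 0, rank G 0),
    homog_mx (shift (f := F) (k := 0)) (shift (f := G) (k := 0)) X
    & aug_col F = X *m aug_col G.
  have [X EX]: exists X, aug_col F = X *m aug_col G.
    apply: factor_rows => i; have /IJ := aug_in i eF.
    case: (eG) => HJ _ _ /HJ[w Ew]; exists w.
    by apply/matrixP=> a b; rewrite !ord1 augmentE -Ew !mxE.
  exact: homog_mx_lift (graded_aug gF) (graded_aug gG) EX.
(* Besides homogeneity, the invariant contains the factorization that yields the next matrix. *)
pose good k (X : 'M[S]_(rank F k, rank G k)) :=
  homog_mx (shift (f := F) (k := k)) (shift (f := G) (k := k)) X /\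
  exists Y, diff F k *m X = Y *m diff G k.
pose commutes k (X : 'M[S]_(rank F k, rank G k)) Y :=
  diff F k *m X = Y *m diff G k.
have [|k X [hX [Y EY]]|phi [phiE good_phi phi_comm]] :=
    @dependent_sequence (fun k => 'M[S]_(rank F k, rank G k)) good commutes phi0.
- split=> //; apply: (factor_diff0 eG).
  by rewrite -mulmxA -aug0 (diff0_aug eF).
- have hFX := homog_mx_mul (graded_diff (k := k) gF) hX.
  have [Z hZ EZ] := homog_mx_lift hFX (graded_diff (k := k) gG) EY.
  exists Z => //; split=> //; apply: (factor_diff eG).
  by rewrite -mulmxA -EZ mulmxA (diff_diff _ eF) mul0mx.
- exists phi; split=> [k||//]; last by rewrite phiE.
  by have [] := good_phi k.
Qed.

(* [phi k *m psi k] is homotopic to the identity, so by minimality it is the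
   identity modulo the maximal ideal. *)
Lemma residue_comparison I F n (phi : forall k, 'M[S]_(rank F k, n k))
    (psi : forall k, 'M[S]_(n k, rank F k)) :
  exact I F -> minimal F ->
  aug_col F = phi 0 *m psi 0 *m aug_col F ->
  (forall k, diff F k *m (phi k *m psi k) = phi k.+1 *m psi k.+1 *m diff F k) ->
  forall k, residue (phi k *m psi k) = 1%:M.
Proof.
move=> eF mF aug0 comm.
have mF0 k : residue (diff F k) = 0 by apply/matrixP=> i j; rewrite !mxE mF.
(* [h] is the homotopy in degree [k], and [E] is the contribution of the one in the degree below,
   which is 0 when [k] is 0. *)
suff homotopy k : exists E h, [/\ phi k *m psi k - 1%:M = E + h *m diff F k,
    diff F k *m E = 0 & residue E = 0].
  move=> k; have [E [h [Ek _ E0]]] := homotopy k.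
  rewrite -[phi k *m _](subrK 1%:M) Ek /residue !map_mxD map_mxM.
  rewrite -/(residue E) -/(residue (diff F k)) E0 mF0 mulmx0 !add0r.
  exact: map_mx1.
elim: k => [|k [E [h [Ek FE0 _]]]].
  have [|h Eh] := @factor_diff0 I F _ (phi 0 *m psi 0 - 1%:M) eF.
    by rewrite mulmxBl -aug0 mul1mx subrr.
  exists 0, h; split; rewrite ?add0r ?mulmx0 //.
  exact: map_mx0.
have [|h' Eh'] := @factor_diff I F k _
    (phi k.+1 *m psi k.+1 - 1%:M - diff F k *m h) eF.
  rewrite !mulmxBl -comm mul1mx -[X in _ - X - _]mulmx1 -mulmxBr Ek.
  by rewrite mulmxDr FE0 add0r mulmxA subrr.
exists (diff F k *m h), h'; split.
- by rewrite -Eh' [RHS]addrC subrK.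
- by rewrite mulmxA (diff_diff _ eF) mul0mx.
- by rewrite residueM mF0 mul0mx.
Qed.

(** The residue of [phi k *m psi k] is the identity, so row [i] of the residue of [phi k] has a
    nonzero entry. A homogeneous entry with nonzero constant term has degree 0, hence the two shifts
    agree. Multiplicities are ignored, as only a maximum is wanted. *)
Lemma minimal_resolution_shift I F G k (i : 'I_(rank F k)) :
  minimal_graded_free_resolution (V := S^o) (@homog_poly K N) I F ->
  minimal_graded_free_resolution (V := S^o) (@homog_poly K N) I G ->
  exists j : 'I_(rank G k), shift j = shift i.
Proof.
move=> [gF eF _ mF] [gG eG _ _].
have [phi [hphi augF commF]] := comparison_map gF gG eF eG (fun x h => h).
have [psi [hpsi augG commG]] := comparison_map gG gF eG eF (fun x h => h).
have := residue_comparison (phi := phi) (psi := psi) eF mF.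
rewrite -mulmxA -augG -augF => /(_ erefl) H.
have {H} /H /(_ k) : forall k,
    diff F k *m (phi k *m psi k) = phi k.+1 *m psi k.+1 *m diff F k.
  by move=> l; rewrite mulmxA commF -!mulmxA commG.
move=> /matrixP /(_ i i); rewrite residueM !mxE eqxx => E.
have [j nz] : exists j, residue (phi k) i j != 0.
  apply/existsP; apply/existsPn => H; move/eqP: E.
  rewrite big1 ?(eq_sym 0) ?oner_eq0 // => j _.
  by have := H j; rewrite negbK => /eqP ->; rewrite mul0r.
exists j; move: nz; rewrite mxE => /(homog_poly_coef0 (hphi k i j)) /eqP.
by rewrite subr_eq0 => /eqP.
Qed.

End Resolutions.

(** * Mapping cones *)

Definition resolves (K : fieldType) (N : nat) (I : {mpoly K[N]}^o -> Prop)
    (F : free_sequence ({mpoly K[N]}^o)) :=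
  minimal_graded_free_resolution (V := {mpoly K[N]}^o) (@homog_poly K N) I F.

Definition has_shift (K : fieldType) (N : nat)
    (F : free_sequence ({mpoly K[N]}^o)) k d :=
  exists i : 'I_(rank F k), shift i = d.

Section BlockShifts.
Variables (K : fieldType) (N : nat).

Definition sum_shift a b (s : 'I_a -> int) (t : 'I_b -> int) (i : 'I_(a + b)) :=
  match split i with inl j => s j | inr j => t j end.

Lemma sum_shiftP a b (s : 'I_a -> int) (t : 'I_b -> int) d :
  (exists i, sum_shift s t i = d) <-> (exists i, s i = d) \/ (exists i, t i = d).
Proof.
split=> [[i]|].
  by rewrite /sum_shift; case: (split i) => j Ej; [left | right]; exists j.
rewrite /sum_shift; case=> -[i Ei].
  by exists (unsplit (inl i)); rewrite unsplitK.
by exists (unsplit (inr i)); rewrite unsplitK.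
Qed.

Lemma homog_row_mx a b c (s : 'I_a -> int) (t : 'I_b -> int) (u : 'I_c -> int)
    (A : 'M[{mpoly K[N]}]_(a, b)) B :
  homog_mx s t A -> homog_mx s u B -> homog_mx s (sum_shift t u) (row_mx A B).
Proof. by move=> hA hB i j; rewrite mxE /sum_shift; case: split => k. Qed.

Lemma homog_col_mx a b c (s : 'I_a -> int) (t : 'I_b -> int) (u : 'I_c -> int)
    (A : 'M[{mpoly K[N]}]_(a, c)) B :
  homog_mx s u A -> homog_mx t u B -> homog_mx (sum_shift s t) u (col_mx A B).
Proof. by move=> hA hB i j; rewrite mxE /sum_shift; case: split => k. Qed.

Lemma homog_mx0 a b (s : 'I_a -> int) (t : 'I_b -> int) :
  homog_mx s t (0 : 'M[{mpoly K[N]}]_(a, b)).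
Proof. by move=> i j; rewrite mxE; apply: homog_poly0. Qed.

Lemma homog_mxN a b (s : 'I_a -> int) (t : 'I_b -> int) (A : 'M[{mpoly K[N]}]_(a, b)) :
  homog_mx s t A -> homog_mx s t (- A).
Proof. by move=> hA i j; rewrite mxE; apply/homog_polyN/hA. Qed.

End BlockShifts.

Section Cone.
Variables (K : fieldType) (N : nat).
Local Notation S := {mpoly K[N]}.
Variables F G H : free_sequence ({mpoly K[N]}^o).
Variables (phi : forall k, 'M[S]_(rank H k, rank F k))
          (psi : forall k, 'M[S]_(rank H k, rank G k)).

(** This and the next two definitions move [H] up by one homological degree, with the zero module in
    degree 0. *)
Definition prev_rank k := if k is k'.+1 then rank H k' else 0%N.

Definition prev_shift k : 'I_(prev_rank k) -> int :=
  match k with 0 => fun=> 0 | k'.+1 => @shift _ _ _ H k' end.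

Definition prev_diff k : 'M[S]_(rank H k, prev_rank k) :=
  match k with 0 => 0 | k'.+1 => diff H k' end.

Definition cone_rank k := (rank F k + rank G k + prev_rank k)%N.

Definition cone_shift k : 'I_(cone_rank k) -> int :=
  sum_shift (sum_shift (@shift _ _ _ F k) (@shift _ _ _ G k)) (@prev_shift k).

(** The last block of rows maps [H] to [F], [G] and the moved [H]. The opposite signs of [phi] and
    [psi] encode the embedding of the intersection by [x] to [(x, -x)]; the sign of [prev_diff]
    makes consecutive maps compose to 0. *)
Definition cone_diff k : 'M[S]_(cone_rank k.+1, cone_rank k) :=
  block_mx (block_mx (diff F k) 0 0 (diff G k)) 0
           (row_mx (phi k) (- psi k)) (- prev_diff k).

Definition cone_aug_col : 'M[S]_(cone_rank 0, 1) :=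
  col_mx (col_mx (aug_col F) (aug_col G)) 0.

Definition cone : free_sequence ({mpoly K[N]}^o) :=
  @FreeSequence _ _ ({mpoly K[N]}^o) cone_rank cone_shift cone_diff
    (fun i => cone_aug_col i 0).

Lemma aug_col_cone : aug_col cone = cone_aug_col.
Proof. by apply/matrixP=> i j; rewrite mxE ord1. Qed.

Lemma has_shift_cone k d :
  has_shift cone k d <->
  [\/ has_shift F k d, has_shift G k d | exists2 k', k = k'.+1 & has_shift H k' d].
Proof.
rewrite /has_shift; split.
  move=> /sum_shiftP[/sum_shiftP[]|]; first by constructor 1.
    by constructor 2.
  by move=> [i Ei]; constructor 3; case: k i Ei => [[]|k] //= i Ei; exists k => //; exists i.
move=> h; apply/sum_shiftP; case: h => [h|h|[k' -> h]].
- by left; apply/sum_shiftP; left.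
- by left; apply/sum_shiftP; right.
- by right.
Qed.

Variables I J L M : {mpoly K[N]}^o -> Prop.
Hypothesis (resF : resolves I F) (resG : resolves J G) (resH : resolves L H).
Hypothesis (LE : forall x, L x <-> I x /\ J x).
Hypothesis (ME : forall x, M x <-> exists a b, [/\ I a, J b & x = a + b]).
Hypothesis hphi : forall k,
  homog_mx (@shift _ _ _ H k) (@shift _ _ _ F k) (phi k).
Hypothesis hpsi : forall k,
  homog_mx (@shift _ _ _ H k) (@shift _ _ _ G k) (psi k).
Hypothesis aug_phi : aug_col H = phi 0 *m aug_col F.
Hypothesis aug_psi : aug_col H = psi 0 *m aug_col G.
Hypothesis comm_phi : forall k, diff H k *m phi k = phi k.+1 *m diff F k.
Hypothesis comm_psi : forall k, diff H k *m psi k = psi k.+1 *m diff G k.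

Lemma graded_cone : graded cone.
Proof.
have [[[gF _ _ _] [gG _ _ _]] [gH _ _ _]] := (resF, resG, resH).
rewrite /graded /degree_preserving; split=> [i | k].
  change (homog_poly (cone_shift i) (cone_aug_col i 0)).
  rewrite -[cone_shift i]subr0.
  suff : homog_mx (@cone_shift 0) (fun=> 0) cone_aug_col by apply.
  apply: homog_col_mx; last exact: homog_mx0.
  by apply: homog_col_mx; apply: graded_aug.
apply: homog_col_mx; apply: homog_row_mx; last first.
- apply: homog_mxN; case: k => [|k]; first exact: homog_mx0.
  exact: graded_diff gH.
- by apply: homog_row_mx; [apply: hphi | apply/homog_mxN/hpsi].
- exact: homog_mx0.
by apply: homog_col_mx; apply: homog_row_mx;
  first [exact: homog_mx0 | exact: graded_diff].
Qed.

Lemma mul_cone_diff k (a : 'rV_(rank F k.+1)) (b : 'rV_(rank G k.+1)) (c : 'rV_(rank H k)) :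
  (row_mx (row_mx a b) c : 'rV_(cone_rank k.+1)) *m cone_diff k =
  row_mx (row_mx (a *m diff F k + c *m phi k) (b *m diff G k - c *m psi k))
         (- (c *m prev_diff k)).
Proof.
rewrite mul_row_block mul_row_block !mulmx0 !add0r addr0 mul_mx_row add_row_mx.
by rewrite !mulmxN.
Qed.

Lemma mul_cone_aug (a : 'rV_(rank F 0)) (b : 'rV_(rank G 0)) (c : 'rV_0) :
  (row_mx (row_mx a b) c : 'rV_(cone_rank 0)) *m cone_aug_col =
  a *m aug_col F + b *m aug_col G.
Proof. by rewrite mul_row_col mul_row_col mulmx0 addr0. Qed.

Lemma cone_rowP k (v : 'rV[S]_(cone_rank k)) :
  exists a b c, v = row_mx (row_mx a b) c.
Proof.
by exists (lsubmx (lsubmx v)), (rsubmx (lsubmx v)), (rsubmx v); rewrite !hsubmxK.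
Qed.

Lemma prev_diff_diff k : prev_diff k.+1 *m prev_diff k = 0.
Proof.
have [_ eH _ _] := resH; case: k => [|k]; first by rewrite mulmx0.
exact: diff_diff eH.
Qed.


(** A diagram chase on triples, along the short exact sequence from [L] to the direct sum of [I] and
    [J] to [M]. *)
Lemma exact_cone : exact M cone.
Proof.
have [[[_ eF _ _] [_ eG _ _]] [_ eH _ _]] := (resF, resG, resH).
have [[[IE exF0 exF] [JE exG0 exG]] [HE exH0 exH]] := (eF, eG, eH).
split.
- move=> x; split.
    move=> /ME[a [b [/IE[v Ev] /JE[w Ew] Ex]]].
    exists (row_mx (row_mx v w) 0).
    by rewrite -augmentE aug_col_cone mul_cone_aug mxE !augmentE Ex Ev Ew.
  move=> [u Eu]; apply/ME; have [v [w [c Ec]]] := cone_rowP u.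
  exists (augment v), (augment w); split; [by apply/IE; exists v | by apply/JE; exists w |].
  by rewrite Eu -!augmentE aug_col_cone Ec mul_cone_aug mxE.
- move=> u; rewrite -augment_eq0 aug_col_cone.
  have [a [b [c ->]]] := cone_rowP u; rewrite mul_cone_aug (thinmx0 c); split.
    move=> ab0.
    have Eab : a *m aug_col F = - (b *m aug_col G) by apply/eqP; rewrite -addr_eq0 ab0.
    (* The images of [a] and [- b] coincide, so they lie in [I] and in [J], hence in [L]. Correcting
       by a lift [w] to [H] turns [a] and [b] into relations of [F] and [G]. *)
    have /HE[w Ew] : L (augment a).
      apply/LE; split; first by apply/IE; exists a.
      by apply/JE; exists (- b); rewrite -!augmentE Eab mulNmx.
    have {}Ew : w *m aug_col H = a *m aug_col F.
      by apply/matrixP=> i j; rewrite !ord1 !augmentE.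
    have /augment_eq0/exF0[a' Ea'] : (a - w *m phi 0) *m aug_col F = 0.
      by rewrite mulmxBl -mulmxA -aug_phi Ew subrr.
    have /augment_eq0/exG0[b' Eb'] : (b + w *m psi 0) *m aug_col G = 0.
      by rewrite mulmxDl -mulmxA -aug_psi Ew Eab addrN.
    exists (row_mx (row_mx a' b') w); rewrite mul_cone_diff -Ea' -Eb' mulmx0 oppr0.
    by rewrite subrK addrK.
  move=> [w]; have [a' [b' [c' ->]]] := cone_rowP w; rewrite mul_cone_diff.
  move=> /eq_row_mx[/eq_row_mx[-> ->] _]; rewrite mulmxDl mulmxBl -!mulmxA.
  by rewrite !(diff0_aug eF, diff0_aug eG) !mulmx0 -aug_phi -aug_psi add0r sub0r addrN.
move=> k u; have [a [b [c ->]]] := cone_rowP u.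
change (_ *m diff cone k) with ((row_mx (row_mx a b) c : 'rV_(cone_rank k.+1)) *m cone_diff k).
rewrite mul_cone_diff; split.
  rewrite -row_mx0 -row_mx0 => /eq_row_mx[/eq_row_mx[Ea Eb] /eqP].
  rewrite oppr_eq0 => /eqP Ec.
  (* For positive [k] the cycle [c] bounds by exactness of [H]. In degree 0 [prev_diff] gives no
     information: there [c *m phi 0] is a boundary of [F], so the augmentation kills [c]. *)
  have [c' Ec'] : exists w, c = w *m diff H k.
    case: k a b c {u} Ea Eb Ec => [|k] a b c Ea Eb Ec; last exact/exH.
    apply/exH0/augment_eq0; rewrite aug_phi mulmxA.
    have -> : c *m phi 0 = - (a *m diff F 0) by apply/eqP; rewrite -addr_eq0 addrC Ea.
    by rewrite mulNmx -mulmxA (diff0_aug eF) mulmx0 oppr0.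
  have /exF[a' Ea'] : (a + c' *m phi k.+1) *m diff F k = 0.
    by rewrite mulmxDl -mulmxA -comm_phi mulmxA -Ec'.
  have /exG[b' Eb'] : (b - c' *m psi k.+1) *m diff G k = 0.
    by rewrite mulmxBl -mulmxA -comm_psi mulmxA -Ec'.
  (* [- c'] undoes the sign of the [H] block of the cone. *)
  exists (row_mx (row_mx a' b') (- c')).
  change (_ *m diff cone k.+1) with
    ((row_mx (row_mx a' b') (- c') : 'rV_(cone_rank k.+2)) *m cone_diff k.+1).
  rewrite mul_cone_diff -Ea' -Eb' !mulNmx opprK addrK opprK subrK.
  by rewrite Ec'.
move=> [w]; have [a' [b' [c' ->]]] := cone_rowP w.
change (_ *m diff cone k.+1) with
  ((row_mx (row_mx a' b') c' : 'rV_(cone_rank k.+2)) *m cone_diff k.+1).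
rewrite mul_cone_diff => /eq_row_mx[/eq_row_mx[-> ->] ->].
rewrite !mulNmx -!mulmxA prev_diff_diff mulmx0 oppr0.
rewrite mulmxDl mulmxBl -!mulmxA (diff_diff _ eF) (diff_diff _ eG).
by rewrite -comm_phi -comm_psi !mulmx0 add0r sub0r opprK !addrN addNr oppr0 !row_mx0.
Qed.

Lemma finite_length_cone : finite_length cone.
Proof.
have [[[_ _ [f hF] _] [_ _ [g hG] _]] [_ _ [h hH] _]] := (resF, resG, resH).
(* The successor accounts for [H] sitting one degree higher in the cone. *)
exists (f + g + h).+1 => -[|k] // hk.
by rewrite /= /cone_rank /= hF ?hG ?hH //; lia.
Qed.

Lemma residue_eq0 a b (s : 'I_a -> int) (t : 'I_b -> int) (A : 'M[S]_(a, b)) :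
  homog_mx s t A -> (forall i j, s i <> t j) -> residue A = 0.
Proof.
move=> hA st; apply/matrixP=> i j; rewrite !mxE; apply/eqP/contraT.
by move=> /(homog_poly_coef0 (hA i j))/eqP; rewrite subr_eq0 => /eqP/st.
Qed.

(** The diagonal blocks are minimal by assumption; [phi] and [psi] have no constant terms because
    source and target share no shift in the same homological degree. *)
Lemma minimal_cone :
  (forall k d, has_shift H k d -> ~ has_shift F k d) ->
  (forall k d, has_shift H k d -> ~ has_shift G k d) -> minimal cone.
Proof.
have [[[_ _ _ mF] [_ _ _ mG]] [_ _ _ mH]] := (resF, resG, resH).
move=> HF HG k i j.
suff /matrixP/(_ i j) : residue (cone_diff k) = 0 by rewrite !mxE.
have res0 a b (A : 'M[S]_(a, b)) : (forall i j, (A i j)@_0%MM = 0) -> residue A = 0.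
  by move=> A0; apply/matrixP=> ? ?; rewrite !mxE A0.
have resphi : residue (phi k) = 0.
  apply: (residue_eq0 (hphi (k := k))) => i' j' E.
  by apply: (HF k (shift i')); [exists i' | exists j'].
have respsi : residue (psi k) = 0.
  apply: (residue_eq0 (hpsi (k := k))) => i' j' E.
  by apply: (HG k (shift i')); [exists i' | exists j'].
have resH' : residue (prev_diff k) = 0.
  by apply: res0; case: (k) => [|k'] i' j'; [rewrite mxE mcoeff0 | apply: mH].
rewrite /residue map_block_mx map_block_mx map_row_mx !map_mxN !map_mx0.
rewrite -!/(residue _) resphi respsi resH' !res0 //.
by rewrite !oppr0 row_mx0 !block_mx0.
Qed.

End Cone.

(** This form serves both for adjoining a variable and for the final sum; the description of the
    shifts carries the degrees through. *)
Lemma resolution_sum (K : fieldType) (N : nat) (I J L M : {mpoly K[N]}^o -> Prop) F G H :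
  resolves I F -> resolves J G -> resolves L H ->
  (forall x, L x <-> I x /\ J x) ->
  (forall x, M x <-> exists a b, [/\ I a, J b & x = a + b]) ->
  (forall k d, has_shift H k d -> ~ has_shift F k d) ->
  (forall k d, has_shift H k d -> ~ has_shift G k d) ->
  exists2 C, resolves M C & forall k d, has_shift C k d <->
    [\/ has_shift F k d, has_shift G k d | exists2 k', k = k'.+1 & has_shift H k' d].
Proof.
move=> resF resG resH LE ME HF HG.
have [[[gF eF _ _] [gG eG _ _]] [gH eH _ _]] := (resF, resG, resH).
have [phi [hphi aphi cphi]] := comparison_map gH gF eH eF (fun x h => proj1 (proj1 (LE x) h)).
have [psi [hpsi apsi cpsi]] := comparison_map gH gG eH eG (fun x h => proj2 (proj1 (LE x) h)).
exists (cone phi psi); last by move=> k d; apply: has_shift_cone.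
split.
- exact: graded_cone resF resG resH hphi hpsi.
- exact: exact_cone resF resG resH LE ME aphi apsi cphi cpsi.
- exact: finite_length_cone resF resG resH.
- exact: minimal_cone resF resG resH hphi hpsi HF HG.
Qed.

(** * Linear resolutions of squarefree monomial ideals *)

Section LinearResolutions.
Variables (K : fieldType) (N : nat).
Local Notation S := {mpoly K[N]}.
Implicit Types (P Q : pred 'X_{1..N}) (F : free_sequence ({mpoly K[N]}^o)).

Lemma resolves_ext (I J : {mpoly K[N]}^o -> Prop) F :
  (forall x, I x <-> J x) -> resolves I F -> resolves J F.
Proof.
move=> IJ [gF [IE ex0 exS] fF mF]; split=> //; split=> // x.
by rewrite -IJ.
Qed.

Lemma monomial_ideal_predI P Q (p : S) :
  monomial_ideal (predI P Q) p <-> monomial_ideal P p /\ monomial_ideal Q p.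
Proof.
by rewrite /monomial_ideal all_predI; split=> [/andP|[-> ->]].
Qed.

Lemma monomial_ideal_predU P Q (p : S) :
  monomial_ideal (predU P Q) p <->
  exists a b, [/\ monomial_ideal P a, monomial_ideal Q b & p = a + b].
Proof.
split=> [PQp | [a [b [Pa Qb ->]]]]; last first.
  by apply: monomial_idealD; [apply: sub_monomial_ideal Pa | apply: sub_monomial_ideal Qb];
    move=> m /= ->; rewrite ?orbT.
exists (restrict P p), (restrict (predC P) p).
split; [exact: monomial_ideal_restrictW | | by rewrite restrictK].
apply: sub_monomial_ideal (monomial_ideal_restrict (predC P) PQp) => m /=.
by case: (P m) => //=; rewrite andbT.
Qed.

(** A resolution of rank zero everywhere qualifies for every [d], so the zero ideal is linear in any
    degree. *)
Definition linear_resolution d Q F :=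
  resolves (monomial_ideal Q) F /\ forall k e, has_shift F k e -> e = d + k%:Z.

Definition has_linear_resolution d Q := exists F, linear_resolution d Q F.

Lemma eq_linear_resolution d P Q :
  P =1 Q -> has_linear_resolution d P -> has_linear_resolution d Q.
Proof.
move=> PQ [F [resF sF]]; exists F; split=> //.
by apply: resolves_ext resF => p; rewrite /monomial_ideal (eq_all PQ).
Qed.

Lemma linear_resolution_pred0 d : has_linear_resolution d pred0.
Proof.
exists (@FreeSequence K N ({mpoly K[N]}^o) (fun=> 0%N) (fun _ _ => 0) (fun=> 0) (fun=> 0)).
split; last by move=> k e [[]].
split; last by move=> k [].
- by split=> [[]|k []].
- split=> [x|v|k v] /=.
  + rewrite /augment; split=> [H|[v ->]]; last by rewrite big_ord0; apply: monomial_ideal0.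
    exists 0; rewrite big_ord0; apply: msuppnil0.
    by move: H; rewrite /monomial_ideal all_pred0 size_eq0 => /eqP.
  + rewrite /augment big_ord0; split=> // _; by exists 0; rewrite mulmx0; apply: thinmx0.
  + split=> _; last by rewrite mulmx0.
    by exists 0; rewrite mulmx0; apply: thinmx0.
- by exists 0%N.
Qed.

Lemma linear_resolution_predT : has_linear_resolution 0 predT.
Proof.
exists (@FreeSequence K N ({mpoly K[N]}^o) (fun k => if k is 0 then 1%N else 0%N)
  (fun _ _ => 0) (fun=> 0) (fun=> 1)).
split; last by move=> [|k] e [] [].
split.
- split=> [i|k []//]; exact: homog_poly1.
- split=> [x|v|k v] /=; rewrite /augment.
  + split=> _; last exact: monomial_ideal_predT.
    by exists (x%:M); rewrite /augment big_ord1 mxE mulr1n /GRing.scale /= mulr1.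
  + rewrite big_ord1 /GRing.scale /= mulr1; split=> [v0|[w ->]].
      by exists 0; rewrite mulmx0; apply/matrixP=> i j; rewrite !ord1 v0 mxE.
    by rewrite mulmx0 mxE.
  + split=> _; last by rewrite mulmx0.
    by exists 0; rewrite mulmx0; apply: thinmx0.
- by exists 0%N => -[].
- by move=> k [].
Qed.

(** Since [Q] ignores the exponent of [a], termwise division by ['X_a] stays inside [Q]. *)
Lemma monomial_ideal_mulX (a : 'I_N) Q (p : S) :
  (forall m, Q (m + U_(a))%MM = Q m) ->
  monomial_ideal (fun m => (0 < m a)%N && Q m) p <->
  exists2 p', monomial_ideal Q p' & p = 'X_a * p'.
Proof.
move=> Qa; split=> [/allP Qp | [p' Qp' ->]]; last first.
  apply: (monomial_idealM (P := pred1 U_(a)%MM)) Qp'; last first.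
    by apply: monomial_idealX; rewrite /= eqxx.
  by move=> b m /eqP -> Qm; rewrite addmC mnmDE mnm1E eqxx addn1 Qa.
exists (\sum_(m <- msupp p) p@_m *: 'X_[m - U_(a)]).
  rewrite big_seq; apply: monomial_ideal_sum => m /Qp /andP[ma Qm].
  apply/monomial_idealZ/monomial_idealX; rewrite -Qa submK //.
  by apply/mnm_lepP => i; rewrite mnm1E; case: eqP => [<-|].
rewrite {1}(mpolyE p) mulr_sumr big_seq [RHS]big_seq; apply: eq_bigr => m /Qp /andP[ma _].
rewrite -scalerAr -mpolyXD addmC submK //.
by apply/mnm_lepP => i; rewrite mnm1E; case: eqP => [<-|].
Qed.

(** Multiplication by ['X_a] is injective of degree 1: the same differentials resolve the product
    once the augmentation is multiplied by ['X_a] and all shifts are raised by 1. *)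
Lemma linear_resolution_mulX (a : 'I_N) d Q :
  (forall m, Q (m + U_(a))%MM = Q m) ->
  has_linear_resolution d Q ->
  has_linear_resolution (d + 1) (fun m => (0 < m a)%N && Q m).
Proof.
move=> Qa [F [[[haug hdiff] [QE ex0 exS] fF mF] sF]].
pose G := @FreeSequence K N ({mpoly K[N]}^o) (rank F)
  (fun k i => shift (f := F) (k := k) i + 1) (diff F)
  (fun i => ('X_a * (aug (f := F) i : S) : S)).
have augG (v : 'rV_(rank F 0)) : augment (F := G) v = 'X_a * augment (F := F) v.
  by rewrite /augment mulr_sumr; apply: eq_bigr => i _; rewrite /GRing.scale /= mulrCA.
exists G; split; last first.
  by move=> k e [i <-] /=; rewrite (sF k (shift (f := F) i)); [ring | exists i].
split=> //.
- split=> [i|k i j] /=.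
    by rewrite addrC; apply: homog_polyM (homog_polyXU _ _) (haug i).
  by rewrite opprD addrACA subrr addr0; apply: hdiff.
- split=> [x|v|//].
    rewrite (monomial_ideal_mulX _ Qa); split=> [[p' /QE[v ->] ->]|[v ->]].
      by exists v; rewrite augG.
    by exists (augment (F := F) v); rewrite ?augG //; apply/QE; exists v.
  rewrite -ex0 augG; split=> [/eqP|->]; last by rewrite mulr0.
  by rewrite mulf_eq0 -msupp_eq0 msuppX => /eqP.
Qed.

(** The cone moves the shift [d + 1 + k] of the intersection into homological degree [k + 1], where
    it is again linear. It also differs from [d + k], which gives minimality. *)
Lemma linear_resolution_predU d P Q :
  has_linear_resolution d P -> has_linear_resolution d Q ->
  has_linear_resolution (d + 1) (predI P Q) ->
  has_linear_resolution d (predU P Q).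
Proof.
move=> [F [resF sF]] [G [resG sG]] [H [resH sH]].
have [k e /sH-> /sF|k e /sH-> /sG|C resC sC] := resolution_sum resF resG resH
  (monomial_ideal_predI P Q) (monomial_ideal_predU P Q); [lia | lia |].
exists C; split=> // k e /sC[/sF//|/sG//|[k' -> /sH->]].
by lia.
Qed.

(** Equivalently, some squarefree monomial of degree [k] in the variables of [A] divides the
    monomial; counting the occurring variables avoids choosing one. *)
Definition at_least (A : {set 'I_N}) k : pred 'X_{1..N} :=
  fun m => (k <= #|[set i in A | (0 < m i)%N]|)%N.

Lemma at_least_setU1 a (A : {set 'I_N}) k m :
  a \notin A ->
  at_least (a |: A) k.+1 m = at_least A k.+1 m || (0 < m a)%N && at_least A k m.
Proof.
move=> aA; rewrite /at_least.
have aA' : a \notin [set i in A | (0 < m i)%N] by rewrite inE (negPf aA).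
have -> : [set i in a |: A | (0 < m i)%N] =
    if (0 < m a)%N then a |: [set i in A | (0 < m i)%N] else [set i in A | (0 < m i)%N].
  apply/setP=> i; case: ifP => ma; rewrite !inE; case: eqP => [->|_] //=.
  by rewrite ma andbF.
case: ifP => /= _; last by rewrite orbF.
rewrite cardsU1 aA' add1n ltnS; case: ltnP => //= h.
by rewrite ltnW.
Qed.

Lemma at_leastD1 a (A : {set 'I_N}) k m :
  a \notin A -> at_least A k (m + U_(a))%MM = at_least A k m.
Proof.
move=> aA; rewrite /at_least; congr (_ <= #|pred_of_set _|)%N.
apply/setP=> i; rewrite !inE mnmDE mnm1E; case: eqP => [<-|_]; last by rewrite addn0.
by rewrite (negPf aA).
Qed.

(** Induction on the size of [A], removing one variable. The predicate [Q], free of the variables of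
    [A], is carried along so that applying the lemma twice handles two disjoint sets of
    variables. *)
Lemma linear_resolution_at_least (A : {set 'I_N}) k d Q :
  (forall a m, a \in A -> Q (m + U_(a))%MM = Q m) ->
  has_linear_resolution d Q ->
  has_linear_resolution (d + k%:Z) (predI (at_least A k) Q).
Proof.
move=> QA linQ.
have lin0 B : has_linear_resolution (d + 0%:Z) (predI (at_least B 0) Q).
  by rewrite addr0; apply: eq_linear_resolution linQ.
move: {2}#|A| (erefl #|A|) => n; elim: n A QA k => [|n IH] A QA [|k] cA; try exact: lin0.
  (* No variables remain but at least one is required: the ideal is zero. *)
  apply: eq_linear_resolution (linear_resolution_pred0 _) => m.
  move/eqP: cA; rewrite cards_eq0 => /eqP -> /=.
  rewrite /at_least; have -> : [set i in set0 | (0 < m i)%N] = set0.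
    by apply/setP=> i; rewrite !inE.
  by rewrite cards0.
have /card_gt0P[a aA] : (0 < #|A|)%N by rewrite cA.
have cA' : #|A :\ a| = n by move: cA; rewrite (cardsD1 a) aA => -[].
have QA' b m : b \in A :\ a -> Q (m + U_(b))%MM = Q m by move=> /setD1P[_ /QA].
have aA' : a \notin A :\ a by rewrite setD11.
have indep l m :
    predI (at_least (A :\ a) l) Q (m + U_(a))%MM = predI (at_least (A :\ a) l) Q m.
  by rewrite /= (at_leastD1 _ _ aA') QA.
(* The three resolutions are those of the two summands and of their intersection, all cut by [Q];
   the last two arise by multiplication by ['X_a]. *)
have L1 := IH _ QA' k.+1 cA'.
have L2 := linear_resolution_mulX (indep k) (IH _ QA' k cA').
have L3 := linear_resolution_mulX (indep k.+1) L1.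
rewrite (_ : d + k%:Z + 1 = d + k.+1%:Z) in L2; last by lia.
apply: eq_linear_resolution (linear_resolution_predU L1 L2 _) => [m|].
  rewrite -[in RHS](setD1K aA) /= (at_least_setU1 _ _ aA').
  by rewrite andb_orl andbA.
apply: eq_linear_resolution L3 => m /=.
case: (boolP (at_least _ k.+1 m)) => [h|]; last by rewrite andbF.
have -> : at_least (A :\ a) k m by apply: ltnW.
by case: (Q m); rewrite ?andbF ?andbT.
Qed.

Lemma linear_resolution_bigraded (A B : {set 'I_N}) k l :
  [disjoint A & B] ->
  has_linear_resolution (k + l)%N%:Z (predI (at_least A k) (at_least B l)).
Proof.
move=> AB; rewrite addnC PoszD; apply: linear_resolution_at_least => [a m aA|].
  by apply: at_leastD1; rewrite (disjointFr AB aA).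
rewrite -[l%:Z]add0r.
apply: eq_linear_resolution
  (linear_resolution_at_least (A := B) l _ linear_resolution_predT) => //.
by move=> m /=; rewrite andbT.
Qed.

End LinearResolutions.

(** * From generators to supports *)

Section GeneratedIdeals.
Variable R : comNzRingType.
Implicit Types (G I J : R -> Prop).

Lemma ideal_gen_ind G (P : R -> Prop) p :
  P 0 -> (forall x y, P x -> P y -> P (x + y)) ->
  (forall c g, G g -> P (c * g)) -> ideal_gen G p -> P p.
Proof.
by move=> P0 PD PG [k [c [g [Gg ->]]]]; apply: big_ind => // i _; apply/PG/Gg.
Qed.

Lemma ideal_gen0 G : ideal_gen G 0.
Proof.
exists 0%N, (fun=> 0), (fun=> 0); split=> [[]|] //.
by rewrite big_ord0.
Qed.

Lemma ideal_gen_mem G c g : G g -> ideal_gen G (c * g).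
Proof. by move=> Gg; exists 1%N, (fun=> c), (fun=> g); rewrite big_ord1. Qed.

Lemma ideal_genD G p q : ideal_gen G p -> ideal_gen G q -> ideal_gen G (p + q).
Proof.
move=> [k [c [g [Gg ->]]]] [l [d [h [Gh ->]]]].
exists (k + l)%N, (fun i => match split i with inl j => c j | inr j => d j end),
  (fun i => match split i with inl j => g j | inr j => h j end).
split=> [i|]; first by case: split.
rewrite big_split_ord; congr (_ + _); apply: eq_bigr => i _.
  by rewrite (unsplitK (inl i)).
by rewrite (unsplitK (inr i)).
Qed.

Lemma sub_ideal_gen G G' p :
  (forall x, G x -> G' x) -> ideal_gen G p -> ideal_gen G' p.
Proof.
by move=> GG' [k [c [g [Gg ->]]]]; exists k, c, g; split=> // i; apply/GG'/Gg.
Qed.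

Lemma eq_ideal_mul I I' J J' p :
  (forall x, I x <-> I' x) -> (forall x, J x <-> J' x) ->
  ideal_mul I J p <-> ideal_mul I' J' p.
Proof.
by move=> II' JJ'; split; apply: sub_ideal_gen => x [a [b [/II' ? /JJ' ? ->]]];
  exists a, b.
Qed.

End GeneratedIdeals.

Section SquareFreeMonomials.
Variables (K : fieldType) (N : nat).
Local Notation S := {mpoly K[N]}.
Implicit Types (A B X Y : {set 'I_N}) (m : 'X_{1..N}).

Definition sqfree_mnm B : 'X_{1..N} := (\sum_(i in B) U_(i))%MM.

Lemma sqfree_mnmE B j : sqfree_mnm B j = (j \in B).
Proof.
rewrite mnm_sumE; case: (boolP (j \in B)) => jB.
  rewrite (bigD1 j) //= mnm1E eqxx big1 ?addn0 // => i /andP[_ ij].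
  by rewrite mnm1E (negPf ij).
rewrite big1 // => i iB; rewrite mnm1E; case: eqP => // ij.
by rewrite -ij iB in jB.
Qed.

Lemma prod_sqfree_mnm B : \prod_(i in B) 'X_i = 'X_[sqfree_mnm B] :> S.
Proof.
rewrite /sqfree_mnm; elim/big_rec2: _ => [|i m p _ ->]; first by rewrite mpolyX0.
by rewrite mpolyXD.
Qed.

Lemma at_least_sqfree X B k : B \subset X -> #|B| = k -> at_least X k (sqfree_mnm B).
Proof.
move=> BX <-; apply: subset_leq_card; apply/subsetP=> i iB.
by rewrite inE (subsetP BX) // sqfree_mnmE iB.
Qed.

Lemma at_leastP X k m :
  at_least X k m ->
  exists B, [/\ B \subset X, #|B| = k & (sqfree_mnm B <= m)%MM].
Proof.
rewrite /at_least; set E := [set i in X | _] => kE; pose B := [set i in take k (enum E)].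
have BE : B \subset E.
  by apply/subsetP=> i; rewrite inE => /mem_take; rewrite mem_enum.
exists B; split.
- by apply: subset_trans BE _; apply/subsetP=> i; rewrite inE => /andP[].
- rewrite cardsE; have /card_uniqP-> := take_uniq k (enum_uniq E).
  by rewrite size_takel // -cardE.
- apply/mnm_lepP=> i; rewrite sqfree_mnmE; case: (boolP (i \in B)) => //= /(subsetP BE).
  by rewrite inE => /andP[].
Qed.

Lemma at_least_addl X k a b : at_least X k b -> at_least X k (a + b)%MM.
Proof.
move/leq_trans; apply; apply: subset_leq_card; apply/subsetP=> i.
by rewrite !inE mnmDE => /andP[-> h]; rewrite addn_gt0 h orbT.
Qed.

Lemma at_least_leq X k l m : (k <= l)%N -> at_least X l m -> at_least X k m.
Proof. exact: leq_trans. Qed.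

(** Every polynomial is the sum of its terms, so generation needs checking on monomials only. This
    serves both the squarefree ideals and their products. *)
Lemma ideal_gen_monomial (G : S -> Prop) (Q : pred 'X_{1..N}) p :
  (forall a b, Q b -> Q (a + b)%MM) ->
  (forall g, G g -> monomial_ideal Q g) ->
  (forall m, Q m -> ideal_gen G 'X_[m]) ->
  ideal_gen G p <-> monomial_ideal Q p.
Proof.
move=> Qadd GQ QG; split.
  apply: ideal_gen_ind; [exact: monomial_ideal0 | exact: monomial_idealD |].
  move=> c g /GQ; apply: monomial_idealM (monomial_ideal_predT c).
  by move=> a b _; apply: Qadd.
move=> /allP Qp; rewrite (mpolyE p) big_seq.
apply: big_ind => [||m /Qp /QG [k [c [g [Gg ->]]]]]; [exact: ideal_gen0 | exact: ideal_genD |].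
exists k, (fun i => p@_m *: c i), g; split=> //.
by rewrite scaler_sumr; apply: eq_bigr => i _; rewrite scalerAl.
Qed.

(** The injection [f] is a parameter so that the [x] and the [y] variables are treated at once. *)
Lemma sqfree_idealP n (f : 'I_n -> 'I_N) k (p : S) :
  injective f ->
  ideal_gen (fun p => exists2 A : {set 'I_n}, #|A| = k & p = \prod_(i in A) 'X_(f i)) p
  <-> monomial_ideal (at_least [set f i | i : 'I_n] k) p.
Proof.
move=> finj; apply: ideal_gen_monomial => [a b|g [A cA ->]|m].
- exact: at_least_addl.
- rewrite -(big_imset (fun j => 'X_j)) /=; last by move=> ? ? _ _ /finj.
  rewrite prod_sqfree_mnm; apply/monomial_idealX/at_least_sqfree.
    by apply/subsetP=> _ /imsetP[i _ ->]; apply: imset_f.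
  by rewrite card_imset.
- move=> /at_leastP[B [BX cB Bm]]; rewrite -(submK Bm) mpolyXD.
  have EB : B = f @: (f @^-1: B).
    apply/setP=> j; apply/idP/imsetP => [jB|[i]]; last by rewrite inE => iB ->.
    have /imsetP[i _ Ei] := subsetP BX j jB.
    by exists i; rewrite // inE -Ei.
  apply: ideal_gen_mem; exists (f @^-1: B); first by rewrite -cB {2}EB card_imset.
  rewrite -prod_sqfree_mnm {1}EB big_imset //.
  by move=> ? ? _ _ /finj.
Qed.

(** Squarefree monomials in disjoint sets of variables are coprime: if both divide a monomial, so
    does their product. Hence the product of the ideals is their intersection. *)
Lemma ideal_mul_at_least X Y k l (p : S) :
  [disjoint X & Y] ->
  ideal_mul (monomial_ideal (at_least X k)) (monomial_ideal (at_least Y l)) p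
  <-> monomial_ideal (predI (at_least X k) (at_least Y l)) p.
Proof.
move=> XY; apply: ideal_gen_monomial => [a b /andP[Xb Yb]|_ [a [b [Xa Yb ->]]]|m].
- by rewrite /= !at_least_addl.
- apply: monomial_idealM Xa Yb => u v Xu Yv.
  by apply/andP; split; [rewrite addmC|]; apply: at_least_addl.
- case/andP=> /at_leastP[B [BX cB Bm]] /at_leastP[C [CY cC Cm]].
  have BCm : (sqfree_mnm B + sqfree_mnm C <= m)%MM.
    apply/mnm_lepP=> i; move/mnm_lepP/(_ i): Bm; move/mnm_lepP/(_ i): Cm.
    rewrite mnmDE !sqfree_mnmE; case: (boolP (i \in B)) => //= /(subsetP BX) iX _.
    by case: (boolP (i \in C)) => //= /(subsetP CY); rewrite (disjointFr XY iX).
  rewrite -(submK BCm) mpolyXD; apply: ideal_gen_mem.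
  exists 'X_[sqfree_mnm B], 'X_[sqfree_mnm C]; rewrite mpolyXD.
  by split=> //; apply/monomial_idealX/at_least_sqfree.
Qed.

End SquareFreeMonomials.

(** * The regularity of the sum *)

Theorem theorem2p8 (K : fieldType) (n m q s t r : nat)
    (hqs : (q < s)%N) (hsn : (s <= n)%N) (htr : (t < r)%N) (hrm : (r <= m)%N) :
  ideal_has_regularity
    (ideal_add (ideal_mul (sqfree_x K n m q) (sqfree_y K n m r))
               (ideal_mul (sqfree_x K n m s) (sqfree_y K n m t)))
    (r%:Z + s%:Z - 1).
Proof.
pose X := [set lshift m i | i : 'I_n]; pose Y := [set rshift n j | j : 'I_m].
have XY : [disjoint X & Y].
  apply/pred0P=> i /=; apply/andP => -[/imsetP[j _ ->] /imsetP[l _ /eqP]].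
  by rewrite eq_lrshift.
pose Q k l := predI (at_least X k) (at_least Y l).
have mulE k l p : ideal_mul (sqfree_x K n m k) (sqfree_y K n m l) p <->
    monomial_ideal (Q k l) p.
  rewrite -ideal_mul_at_least //; apply: eq_ideal_mul => x; apply: sqfree_idealP.
    exact: lshift_inj.
  exact: rshift_inj.
(* Linear resolutions of the two summands, generated in degrees [q + r] and [s + t], and of their
   intersection, generated in degree [s + r]. *)
have [F [resF sF]] := linear_resolution_bigraded K q r XY.
have [G [resG sG]] := linear_resolution_bigraded K s t XY.
have [H [resH sH]] := linear_resolution_bigraded K s r XY.
set M := ideal_add _ _.
(* The shifts of [H] exceed those of [F] by [s - q] and those of [G] by [r - t], both positive, so
   the cone is minimal. *)
have [| |k e /sH-> /sF|k e /sH-> /sG|C resC sC] :=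
    @resolution_sum _ _ _ _ _ M _ _ _ resF resG resH; [| | lia | lia |].
- move=> x; rewrite -monomial_ideal_predI; split; apply: sub_monomial_ideal => u /=.
    move=> /andP[Xu Yu]; rewrite Xu Yu (at_least_leq _ Xu) ?(at_least_leq _ Yu) //;
      exact: ltnW.
  by case/andP=> /andP[_ ->] /andP[->].
- move=> x; split=> -[a [b [/mulE Ia /mulE Jb ->]]]; exists a, b; split=> //; exact/mulE.
(* The product of all variables lies in the intersection, as [s <= n] and [r <= m]; the intersection
   is therefore not zero and [H] has a generator. *)
have [j0 _] : exists j : 'I_(rank H 0), True.
  have [_ [HE _ _] _ _] := resH.
  have /HE[v Ev] : monomial_ideal (Q s r)
      ('X_[sqfree_mnm X + sqfree_mnm Y] : {mpoly K[n + m]}).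
    apply/monomial_idealX/andP; split.
      rewrite addmC.
      apply/at_least_addl/(at_least_leq _ (at_least_sqfree (subxx X) (erefl _))).
      by rewrite card_imset ?card_ord //; apply: lshift_inj.
    apply/at_least_addl/(at_least_leq _ (at_least_sqfree (subxx Y) (erefl _))).
    by rewrite card_imset ?card_ord //; apply: rshift_inj.
  have : augment v != 0 by rewrite -Ev -msupp_eq0 msuppX.
  case: (pickP [pred i : 'I_(rank H 0) | true]) => [j _|no]; first by exists j.
  by rewrite /augment big1 ?eqxx // => j; have := no j.
(* That generator of degree [s + r] enters the cone in homological degree 1 and attains the value
   [s + r - 1]. *)
have topC : has_shift C 1 (s + r)%N%:Z.
  apply/sC; constructor 3; exists 0%N => //; exists j0.
  by rewrite (sH 0%N (shift j0)) ?addr0 //; exists j0.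
split; first by exists C.
move=> F' resF'; split.
  have [j Ej] := topC; have [i Ei] := minimal_resolution_shift j resC resF'.
  by exists 1%N, i; rewrite Ei Ej; lia.
(* Every shift of [F'] occurs in [C]. The terms from [F] and [G] contribute [q + r] and [s + t], at
   most [r + s - 1], and those from [H] exactly [r + s - 1]. *)
move=> k i; have [j <-] := minimal_resolution_shift i resF' resC.
have : has_shift C k (shift j) by exists j.
by move: (shift j) => e /sC[/sF->|/sG->|[k' -> /sH->]]; lia.
Qed.
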